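(* For every $\varepsilon>0$ there exists $N$ such that for every abelian group $A$ of order $n\geq N$, the number of subsets $S\subseteq A$ for which $\mathrm{Cay}(A,S)$ is a DRR is at least $(1-\varepsilon)2^n$. That is, the proportion of subsets $S$ of $A$ such that $\mathrm{Cay}(A,S)$ is a DRR tends to $1$ as $|A|\to\infty$.
   Context: All groups and digraphs are finite. A digraph is a pair $(V,R)$ with $V$ a finite nonempty set and $R\subseteq V\times V$ (loops allowed); its automorphisms are the permutations of $V$ preserving $R$. For a group $G$ and a subset $S\subseteq G$, the Cayley digraph $\mathrm{Cay}(G,S)$ has vertex set $G$, with $(g,h)$ an arc iff $gh^{-1}\in S$ (not required to be connected; loops allowed). $G$ acts regularly on $\mathrm{Cay}(G,S)$ by right multiplication. $\mathrm{Cay}(G,S)$ is a DRR (digraphical regular representation) if its full automorphism group equals this right regular action of $G$. *)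

(* Defs.v *)
From HB Require Import structures.
From mathcomp Require Import all_boot all_order all_algebra all_fingroup.
Set Implicit Arguments. Unset Strict Implicit. Unset Printing Implicit Defensive.

Local Open Scope group_scope.

Definition cay_arc (gT : finGroupType) (S : {set gT}) (g h : gT) : bool :=
  g * h^-1 \in S.

Definition cay_aut (gT : finGroupType) (S : {set gT}) (p : {perm gT}) : bool :=
  [forall g, forall h, cay_arc S (p g) (p h) == cay_arc S g h].

Definition is_DRR (gT : finGroupType) (S : {set gT}) : bool :=
  [forall p : {perm gT}, cay_aut S p ==> [exists a : gT, forall x : gT, p x == x * a]].

(* Main.v *)
(** If [S] is not a DRR, let [G] be a minimal group of automorphisms of [Cay(A, S)] properly
    containing the regular group [A].  When [A] is not self-normalizing in [G], some nontrivial
    group automorphism of [A] preserves [S].  Otherwise [A] meets its conjugates in [Z = Z(G)],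
    so [G / Z] is a Frobenius group with complement [A / Z], and by coprimality the stabilizer
    [G_1] maps onto the Frobenius kernel.  Hence [Z G_1] is normal in [G], and a nontrivial
    element of [G_1] acts on each coset of [Z] as a translation [x |-> x * f x] by an element
    of [Z].  If [C] is the proper subgroup of periods of [f], then for every [c] outside [C]
    the set [S :&: Z c] is invariant under a nontrivial translation by an element of [Z].

    Both situations are rare: [S] is a union of cycles of a permutation fixing at most half of
    the points, and there are few such permutations, since an abelian group of order [n] has
    at most [2 ^ O(log^2 n)] automorphisms and subgroups, while for given [Z] and [C] the
    [(#|Z| - 1) ^ (#|A \ C| / #|Z|)] choices of translations cost less than they save. *)
Require Import Defs.
From HB Require Import structures.
From mathcomp Require Import all_boot all_order all_algebra all_fingroup.
From mathcomp Require Import all_solvable vcharacter zify.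
Import Order.TTheory GRing.Theory Num.Theory.
Local Open Scope ring_scope.

Section CayleyDigraphs.
Local Open Scope group_scope.
Set Implicit Arguments.
Unset Strict Implicit.

(** * Counting stable sets, subgroups and automorphisms *)

(** Every cycle other than a fixed point has at least two points, so adding the fixed points to
    [#|T|] counts each cycle at least twice. *)
Lemma card_porbits_fix (T : finType) (p : {perm T}) :
  (2 * #|porbits p| <= #|T| + #|[set x | p x == x]|)%N.
Proof.
have partP : partition (porbits p) [set: T].
  have -> : porbits p = orbit 'P <[p]> @: [set: T].
    apply/setP=> B; apply/imsetP/imsetP=> -[x _ ->]; exists x; rewrite ?inE //;
    by rewrite porbitE.
  by apply: orbit_partition; apply/actsP=> a _ x; rewrite !inE.
have := card_partition partP; rewrite cardsT => ->.
set F := [set x | _].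
have leF : (#|[set B in porbits p | #|B| == 1%N]| <= #|F|)%N.
  rewrite -(card_imset _ (@set1_inj T)); apply/subset_leq_card/subsetP=> B.
  rewrite inE => /andP[/imsetP[x _ ->] /cards1P[y defB]].
  have xB : x \in porbit p x by exact: porbit_id.
  have /eqP xy: x == y by rewrite -in_set1 -defB.
  have : p x \in porbit p x by have := mem_porbit p 1 x; rewrite expg1.
  by rewrite defB -xy inE => px; apply/imsetP; exists x; rewrite ?inE.
apply: leq_trans (leq_add (leqnn _) leF).
rewrite -sum1_card big_distrr /= -sum1_card [X in (_ <= _ + X)%N]big_mkcond /=.
rewrite [X in (_ <= _ + X)%N](bigID [in porbits p]) /= addnA.
rewrite -big_split /=; apply: leq_trans (leq_addr _ _).
apply: leq_sum => B PB; rewrite inE PB muln1 /=.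
have : (0 < #|B|)%N by case/imsetP: PB => x _ ->; rewrite (cardD1 x) porbit_id.
by case: #|B| => [|[|n]].
Qed.

(** A stable set is a union of cycles, hence determined by the cycles it contains. *)
Lemma card_stable_sets (T : finType) (p : {perm T}) :
  (#|[set S : {set T} | [forall x, (p x \in S) == (x \in S)]]| <= 2 ^ #|porbits p|)%N.
Proof.
rewrite -card_powerset; set D := [set S | _].
pose blocks (S : {set T}) := [set B in porbits p | B \subset S].
have stable S : S \in D -> forall x, porbit p x \subset S = (x \in S).
  rewrite inE => /forallP stS x; apply/idP/idP=> [/subsetP|xS]; first by apply; exact: porbit_id.
  apply/subsetP=> _ /porbitP[i ->]; elim: i => [|i IH]; first by rewrite perm1.
  by rewrite expgSr permM (eqP (stS _)).
rewrite -(@card_in_imset _ _ blocks D) => [|S1 S2 D1 D2 eqB].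
  apply/subset_leq_card/subsetP=> _ /imsetP[S _ ->].
  by rewrite powersetE; apply/subsetP=> B; rewrite inE => /andP[].
apply/setP=> x; rewrite -(stable _ D1) -(stable _ D2).
by have := congr1 (fun U : {set {set T}} => porbit p x \in U) eqB; rewrite !inE imset_f.
Qed.

(** An element outside the subgroup generated so far at least doubles its order, so after [k]
    additions either [H] is generated or the order is at least [2 ^ k], which exceeds [#|gT|]. *)
Lemma small_generating_tuple (gT : finGroupType) k (H : {group gT}) :
  (#|gT| < 2 ^ k)%N -> exists t : k.-tuple gT, <<[set x in t]>> = H.
Proof.
move=> lt_n.
suff [t [_ IH]] : exists t : k.-tuple gT,
   [set x in t] \subset H /\ (<<[set x in t]>> = H \/ 2 ^ k <= #|<<[set x in t]>>|)%N.
  exists t; case: IH => //.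
  by rewrite leqNgt (leq_ltn_trans (max_card _) lt_n).
move: k {lt_n}; elim=> [|k [t [stH IH]]].
  exists [tuple]; split; first by apply/subsetP=> x; rewrite inE.
  by right; rewrite cardG_gt0.
have [x Hx Px] : exists2 x, x \in H & <<[set x in t]>> = H \/ x \notin <<[set x in t]>>.
  have [sH | /subsetPn[x]] := boolP (H \subset <<[set x in t]>>); last by exists x; auto.
  by exists 1 => //; left; apply/eqP; rewrite eqEsubset gen_subG stH.
exists [tuple of x :: t]; set U := [set y in _ :: _].
have sU : [set x in t] \subset U by apply/subsetP=> y; rewrite !inE => ->; rewrite orbT.
have sUH : U \subset H.
  by apply/subsetP=> y; rewrite !inE => /predU1P[-> //|ty]; apply: (subsetP stH); rewrite inE.
split=> //; have sgen := genS sU.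
have [defH|leT] := IH; first by left; apply/eqP; rewrite eqEsubset gen_subG sUH -{1}defH.
case: Px => [defH|notx]; first by left; apply/eqP; rewrite eqEsubset gen_subG sUH -{1}defH.
right; rewrite -(Lagrange sgen) expnSr leq_mul // indexg_gt1.
by apply: contra notx => /subsetP->//; rewrite mem_gen // !inE eqxx.
Qed.

Lemma card_tuples_leq (T : finType) k :
  (#|T| < 2 ^ k)%N -> (#|{: k.-tuple T}| <= 2 ^ (k * k))%N.
Proof.
rewrite card_tuple expnM => /ltnW leT.
by case: k leT => [|k] leT; [rewrite !expn0 | rewrite leq_exp2r].
Qed.

Lemma card_groups (gT : finGroupType) k :
  (#|gT| < 2 ^ k)%N -> (#|{group gT}| <= 2 ^ (k * k))%N.
Proof.
move=> lt_n; apply: (@leq_trans #|{: k.-tuple gT}|); last first.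
  exact: card_tuples_leq.
pose gen (t : k.-tuple gT) := <<[set x in t]>>%G.
rewrite -[X in (X <= _)%N]cardsT -[X in (_ <= X)%N]cardsT.
apply: leq_trans (leq_imset_card gen _); apply/subset_leq_card/subsetP=> H _.
have [t defH] := small_generating_tuple H lt_n.
by apply/imsetP; exists t => //; apply/val_inj/esym.
Qed.

Lemma card_automorphisms (gT : finGroupType) k :
  (#|gT| < 2 ^ k)%N ->
  (#|[set p : {perm gT} | [forall x, forall y, p (x * y)%g == (p x * p y)%g]]| <= 2 ^ (k * k))%N.
Proof.
move=> lt_n; have [t defT] := small_generating_tuple [set: gT]%G lt_n.
set D := [set p | _].
rewrite -(@card_in_imset _ _ (fun p : {perm gT} => [tuple of map p t]) D); last first.
  move=> p q; rewrite !inE => /forallP/= morp /forallP/= morq /(congr1 val)/= /eq_in_map eqpq.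
  have Mp x y : p (x * y) = p x * p y by apply/eqP/(forallP (morp x)).
  have Mq x y : q (x * y) = q x * q y by apply/eqP/(forallP (morq x)).
  (* Two morphisms agree on a subgroup, and [E] contains the generators [t]. *)
  pose E := [set x | p x == q x].
  have gE : group_set E.
    apply/group_setP; split=> [|x y]; rewrite !inE.
      by apply/eqP/(mulgI (p 1)); rewrite -Mp mulg1; apply/(mulIg (q 1)); rewrite -mulgA -Mq !mulg1.
    by rewrite Mp Mq => /eqP-> /eqP->.
  apply/permP=> x; apply/eqP; suff: x \in Group gE by rewrite inE.
  suff /subsetP : [set: gT] \subset Group gE by apply; rewrite inE.
  by rewrite -defT gen_subG; apply/subsetP=> y; rewrite !inE => /eqpq ->.
exact: leq_trans (max_card _) (card_tuples_leq lt_n).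
Qed.

Lemma card_bigcup_leq (I T : finType) (P : pred I) (B : I -> {set T}) :
  (#|\bigcup_(i | P i) B i| <= \sum_(i | P i) #|B i|)%N.
Proof.
elim/big_rec2: _ => [|i m U _ leU]; first by rewrite cards0.
by rewrite (leq_trans (leq_card_setU _ _)) // leq_add2l.
Qed.

(** Choosing a nontrivial translation on a coset of size [m] thus costs at most 2/5 of a bit per
    point, below the half bit per point that stability saves. *)
Lemma pred_exp5_leq_exp4 m : (m.-1 ^ 5 <= 4 ^ m)%N.
Proof.
have [|lt5] := leqP m 5; first by case: m => [|[|[|[|[|[|]]]]]].
(* Equality holds at [m = 5]; afterwards each step multiplies the left side by at most
   [(5/4) ^ 5 < 4]. *)
rewrite -(subnK (ltnW lt5)); move: (m - 5)%N => i.
elim: i => // i IH; rewrite addSn [in X in (_ <= X)%N]expnS.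
apply: leq_trans (leq_mul (leqnn 4) IH).
have -> : (i.+1 + 5).-1 = (i + 4).+1 by lia.
have -> : (i + 5).-1 = (i + 4)%N by lia.
move: (i + 4)%N (leq_addl i 4) => j le4.
have le54 : (4 * j.+1 <= 5 * j)%N by rewrite mulnS mulSn leq_add2r.
rewrite -(leq_pmul2l (m := 4 ^ 5)) // -expnMn mulnA.
apply: leq_trans (_ : (5 * j) ^ 5 <= _)%N; first by rewrite leq_exp2r.
by rewrite expnMn leq_mul2r; apply/orP; right.
Qed.

(** * The Frobenius quotient by the centre *)

(* [G / 'Z(G)] is a Frobenius group with complement [A / 'Z(G)], and the image of [P] is its
   kernel. *)
Lemma center_join_compl_normal (gT : finGroupType) (G A P : {group gT}) :
    abelian A -> maximal A G -> 'N_G(A) = A -> P \subset G ->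
    A :&: P = 1 -> (#|A| * #|P| = #|G|)%N ->
  'Z(G) \subset A /\ 'Z(G) <*> P <| G.
Proof.
move=> cAA /maxgroupP[/andP[sAG not_sGA] maxA] defN sPG tiAP cardG.
have sZA : 'Z(G) \subset A.
  by rewrite -defN subsetI center_sub (subset_trans (subsetIr _ _)) ?cents_norm ?centS.
split=> //; set Z := 'Z(G) in sZA *.
have nZG : G \subset 'N(Z) by rewrite normal_norm ?center_normal.
have nZA := subset_trans sAG nZG; have nZP := subset_trans sPG nZG.
(* By maximality [A] and [A :^ g] generate [G], unless [g] normalizes [A]. Both being abelian, their
   intersection is then central. *)
have tiA g : g \in G -> g \notin A -> A :&: A :^ g \subset Z.
  move=> Gg notAg; have sAgG : A :^ g \subset G by rewrite -(conjGid Gg) conjSg.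
  have defG : A <*> A :^ g = G.
    apply: contraNeq notAg => neqG.
    have defA : A <*> A :^ g = A.
      by apply: maxA; rewrite ?joing_subl // properEneq neqG join_subG sAG.
    rewrite -defN inE Gg inE -{2}defA; apply: subset_trans (joing_subr _ _); exact: subxx.
  rewrite subsetI (subset_trans (subsetIl _ _) sAG) -defG centY subsetI.
  rewrite (subset_trans (subsetIl _ _) cAA).
  by apply: subset_trans (subsetIr _ _) _; rewrite -abelianE abelianJ.
have Frob : [Frobenius G / Z with complement A / Z].
  rewrite /Frobenius_group_with_complement; apply/andP; split.
    apply: contra not_sGA => /eqP eqAG.
    by rewrite -(quotientSGK nZG sZA) eqAG.
  apply/normedTI_memJ_P; split; rewrite ?quotientS //.
    apply: contra not_sGA; rewrite setD_eq0 subG1 => /eqP A1.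
    have sAZ : A \subset Z by rewrite -quotient_sub1 ?A1.
    rewrite -defN subsetI subxx /= cents_norm // centsC.
    by rewrite (subset_trans sAZ) ?subsetIr.
  move=> x y /setD1P[nta Aa] /morphimP[g Ng Gg ->] {y}.
  rewrite !inE conjg_eq1 nta /=; apply/idP/idP=> [Aag | Ag]; last first.
    by rewrite memJ_norm // (subsetP (normG _)).
  case: (boolP (g \in A)) => [Ag | notAg]; first exact: mem_quotient.
  case/negP: nta; move: Aa Aag; case/morphimP=> a Na Aa -> {x}.
  rewrite -morphJ // => Aag.
  have {}Aag : a ^ g \in A.
    by have := mem_morphpre (groupJ Na Ng) Aag; rewrite -/(_ @*^-1 _) quotientGK // /normal sZA.
  have: a ^ g \in A :&: A :^ g by rewrite inE Aag memJ_conjg.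
  move/(subsetP (tiA g Gg notAg)); rewrite (memJ_norm _ Ng) => Za.
  by rewrite -[_ == _]/(coset Z a == 1) coset_id.
have [K frobK] := Frobenius_kernel_exists Frob.
have [/eqP/sdprod_context[nsKG _ _ _ _] _] := andP frobK.
have hallK := Frobenius_ker_Hall frobK.
have [/eqP/sdprod_card cardKA _] := andP frobK.
have tiZP : Z :&: P = 1 by apply/trivgP; rewrite -tiAP setSI.
have cardPZ : #|P / Z| = #|P|.
  exact/esym/card_isog/quotient_isog.
have cardK : #|K| = #|P|.
  apply/eqP; rewrite -(eqn_pmul2r (cardG_gt0 (A / Z))) cardKA !card_quotient //.
  rewrite -(eqn_pmul2r (cardG_gt0 Z)) -mulnA ![(#|_ : _| * _)%N]mulnC !Lagrange //.
    by rewrite -cardG mulnC.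
  exact: center_sub.
(* A normal Hall subgroup contains every subgroup whose order involves only its primes. Equal orders
   then give [P / Z = K]. *)
have sPK : P / Z \subset K.
  rewrite (sub_normal_Hall (Hall_pi hallK)) ?quotientS //.
  by rewrite /pgroup cardPZ -cardK pnat_pi ?cardG_gt0.
have {cardK} defK : P / Z = K by apply/eqP; rewrite eqEcard sPK cardPZ cardK leqnn.
(* [Z <*> P] is the preimage of the normal subgroup [K]. *)
rewrite -(quotientGK (center_normal G)) /= norm_joinEr // -quotientK // defK.
by rewrite morphpre_normal //= ?sub_im_coset.
Qed.

(** * Automorphisms of a Cayley digraph that is not a DRR *)

Lemma cay_autP (gT : finGroupType) (S : {set gT}) (p : {perm gT}) :
  reflect (forall x y, (p x * (p y)^-1 \in S) = (x * y^-1 \in S)) (cay_aut S p).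
Proof.
apply: (iffP forallP) => [autp x y | autp x]; first by apply/eqP/(forallP (autp x)).
by apply/forallP=> y; apply/eqP/autp.
Qed.

Lemma group_set_cay_aut (gT : finGroupType) (S : {set gT}) :
  group_set [set p | cay_aut S p].
Proof.
apply/group_setP; split=> [|p q]; rewrite !inE.
  by apply/cay_autP=> x y; rewrite !perm1.
by move=> /cay_autP autp /cay_autP autq; apply/cay_autP=> x y; rewrite !permM autq.
Qed.

(** The shift [z] may change from one coset [Z :* c] to another, which is all that a single
    automorphism of the digraph provides. *)
Definition translation_stable (gT : finGroupType) (S Z C : {set gT}) :=
  [forall c, (c \notin C) ==>
     [exists z in Z^#, [forall x in Z :* c, (x * z \in S) == (x \in S)]]].

Lemma not_DRR_cases (gT : finGroupType) (S : {set gT}) :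
  abelian [set: gT] -> ~~ is_DRR S ->
    (exists p : {perm gT}, [/\ p != 1, forall x y, p (x * y) = p x * p y
                             & forall x, (p x \in S) = (x \in S)])
  \/ (exists Z C : {group gT}, [/\ Z \subset C, C \proper [set: gT]
                             & translation_stable S Z C]).
Proof.
move=> /centsP cTT; have mC x y : x * y = y * x :> gT by apply: cTT; rewrite inE.
pose rho (a : gT) : {perm gT} := actperm 'R a.
have rhoE a x : rho a x = x * a by rewrite /rho actpermE.
have rhoM a b : rho a * rho b = rho (a * b) by apply/permP=> x; rewrite permM !rhoE mulgA.
have rhoV a : (rho a)^-1 = rho a^-1.
  by apply/eqP; rewrite eq_invg_mul rhoM mulgV; apply/eqP/permP=> x; rewrite rhoE mulg1 perm1.
pose A := (actperm 'R @* [set: gT])%G.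
have memA a : rho a \in A by rewrite mem_morphim ?inE.
have AP p : p \in A -> exists a, p = rho a.
  by case/morphimP=> a _ _ ->; exists a.
have cAA : abelian A by apply: morphim_abelian; apply/centsP.
pose B := Group (group_set_cay_aut S).
move/forallPn=> [q]; rewrite negb_imply => /andP[autq] /existsP notAq.
have notAq' : q \notin A.
  by apply/negP=> /AP[a defq]; apply: notAq; exists a; apply/forallP=> x; rewrite defq rhoE.
have sAB : A \subset B.
  apply/subsetP=> _ /AP[a ->]; rewrite inE; apply/cay_autP=> x y.
  by rewrite !rhoE invMg mulgA mulgK.
pose gP (G : {group {perm gT}}) := (A \proper G) && (G \subset B).
have gPB : gP B.
  by rewrite /gP subxx andbT; apply/properP; split=> //; exists q; rewrite ?inE.
have [G /mingroupP[/andP[prAG sGB] minG] _] := mingroup_exists gPB.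
have sAG := proper_sub prAG.
have autG p : p \in G -> forall x y, (p x * (p y)^-1 \in S) = (x * y^-1 \in S).
  by move/(subsetP sGB); rewrite inE => /cay_autP.
have maxA : maximal A G.
  apply/maxgroupP; split=> // H prHG sAH; apply/eqP; apply: contraT => neqHA.
  have /minG defG : gP H.
    by rewrite /gP properEneq sAH eq_sym neqHA (subset_trans (proper_sub prHG)).
  by move: (prHG); rewrite (defG (proper_sub prHG)) properxx.
have [defN | neqN] := eqVneq 'N_G(A) A; last first.
  left; have /subsetPn[g /setIP[Gg Ng] notAg] : ~~ ('N_G(A) \subset A).
    by apply: contra neqN => sNA; rewrite eqEsubset sNA subsetI sAG normG.
  (* Correcting [g] by a translation makes it fix [1]; a permutation that fixes [1] and normalizes
     the translations is multiplicative. *)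
  pose p := g * rho (g 1)^-1.
  have Gp : p \in G by rewrite groupM // (subsetP sAG).
  have Np : p \in 'N(A) by rewrite groupM // (subsetP (normG _)).
  have p1 : p 1 = 1 by rewrite permM rhoE mulgV.
  have pM x y : p (x * y) = p x * p y.
    have /AP[b def_b] : rho y ^ p \in A by rewrite memJ_norm.
    have eqp u : p (u * y) = p u * b.
      by rewrite -rhoE -permM conjgC def_b permM rhoE.
    by rewrite eqp; congr (_ * _); rewrite -[y in RHS]mul1g eqp p1 mul1g.
  exists p; split=> // [|x].
    apply: contra notAg; rewrite /p -rhoV -eq_mulgV1 => /eqP->; exact: memA.
  by have := autG p Gp x 1; rewrite p1 invg1 !mulg1.
right; pose P := 'C_G[1 | 'P]%G.
have fixP h : h \in P -> h 1 = 1 by case/setIP=> _ /astab1P.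
have tiPA : P :&: A = 1.
  apply/trivgP/subsetP=> h /setIP[/fixP h1 /AP[a defh]]; rewrite inE.
  move: h1; rewrite defh rhoE mul1g => ->; apply/eqP/permP=> x.
  by rewrite rhoE mulg1 perm1.
(* [A] is transitive: each [g] is an element fixing [1] followed by the translation by [g 1]. *)
have defG : P * A = G.
  apply/eqP; rewrite eqEsubset mul_subG ?subsetIl //=; apply/subsetP=> g Gg.
  have -> : g = g * rho (g 1)^-1 * rho (g 1) by rewrite -rhoV mulgKV.
  rewrite mem_mulg // inE groupM // ?(subsetP sAG) //=; apply/astab1P.
  by rewrite /= /aperm permM rhoE mulgV.
have cardG : (#|A| * #|P| = #|G|)%N by rewrite mulnC -defG TI_cardMg.
have tiAP : A :&: P = 1 by rewrite setIC.
have [sZA nsN] := center_join_compl_normal cAA maxA defN (subsetIl _ _) tiAP cardG.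
have ntP : P :!=: 1.
  by apply: contraTneq prAG => P1; rewrite -defG P1 mul1g properxx.
have [g Pg nt_g] := trivgPn _ ntP; have g1 := fixP g Pg.
have Gg : g \in G by case/setIP: Pg.
pose Z := (actperm 'R @*^-1 'Z(G))%G.
have memZ z : (z \in Z) = (rho z \in 'Z(G)) by rewrite !inE.
have gMZ x z : z \in Z -> g (x * z) = g x * z.
  rewrite memZ => /centerP[_ /(_ g Gg) cgz].
  by rewrite -!rhoE -permM cgz permM.
pose f x := x^-1 * g x.
have gE x : g x = x * f x by rewrite mulKVg.
(* [rho x * g * (rho x)^-1] lies in the normal subgroup [P <*> 'Z(G)], so it is some [h * w];
   evaluating at [1] gives [g x = z * x] with [z] in [Z]. *)
have Zf x : f x \in Z.
  have : rho x * g * (rho x)^-1 \in P <*> 'Z(G).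
    rewrite joingC -[_ * _^-1]mulgA -{1}[rho x]invgK -/(g ^ (rho x)^-1).
    rewrite memJ_norm; first by rewrite mem_gen // inE Pg orbT.
    by rewrite (subsetP (normal_norm nsN)) // groupV (subsetP sAG).
  rewrite cent_joinEr; last first.
    by rewrite centsC (subset_trans (subsetIl _ _)) // centsC subsetIr.
  case/mulsgP=> h w Ph Zw; have [z defw] := AP w (subsetP sZA w Zw).
  move/(canRL (mulgKV _))/(congr1 (fun p : {perm gT} => p 1)).
  rewrite defw !permM (fixP h Ph) !rhoE !mul1g /f => ->.
  by rewrite mC mulgK memZ -defw.
have fZ x z : z \in Z -> f (x * z) = f x.
  by move=> Zz; rewrite /f gMZ // mC invMg mulgA mulgK mC.
pose C0 := [set c | [forall a, f (a * c) == f a]].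
have C0P c : reflect (forall a, f (a * c) = f a) (c \in C0).
  by rewrite inE; apply: forallPP => a; apply: eqP.
have gC0 : group_set C0.
  apply/group_setP; split=> [|x y /C0P Cx /C0P Cy]; apply/C0P=> a; first by rewrite mulg1.
  by rewrite mulgA Cy Cx.
exists Z, (Group gC0); split.
- by apply/subsetP=> z Zz; apply/C0P=> a; apply: fZ.
(* If every element were a period, [f] would be constant, equal to [f 1 = 1], and [g] would be
   trivial. *)
- rewrite properT; apply: contra nt_g => /eqP C0T; apply/eqP/permP=> c.
  have /C0P/(_ 1): c \in Group gC0 by rewrite C0T inE.
  by rewrite mul1g gE => ->; rewrite /f g1 invg1 !mulg1 perm1.
apply/forallP=> c; apply/implyP; rewrite inE negb_forall => /existsP[a neqf].
(* Apply [g] to the pair [(a * c * w, a)]: its quotient [w * c] gets multiplied by this element,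
   which is nontrivial by the choice of [a]. *)
apply/existsP; exists (f (a * c) * (f a)^-1).
apply/andP; split; first by rewrite in_setD1 -eq_mulgV1 neqf groupM ?groupV.
apply/forallP=> x; apply/implyP=> /rcosetP[w Zw ->{x}].
apply/eqP; rewrite -[in RHS](mulgK a (w * c)) -(autG g Gg); congr (_ \in S).
clearbody f; have -> : w * c * a = a * c * w by rewrite -mulgA [RHS]mC [a * c]mC.
rewrite !gE (fZ _ w Zw) invMg [RHS]mC -!mulgA mulKg [RHS]mC !mulgA.
by rewrite [c * w]mC.
Qed.

(** * Counting the sets that are not DRRs *)

(** With [n = #|gT|] and [d = n - #|C|], there are at most [2 ^ (2d/5)] choices of translations,
    each leaving at most [2 ^ (n - d/2)] sets. The gain [d/10] is at least [n/20] because [C] has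
    index at least 2. *)
Lemma card_translation_stable (gT : finGroupType) (Z C : {group gT}) :
    abelian [set: gT] -> Z \subset C -> C \proper [set: gT] ->
  (#|[set S | translation_stable S Z C]| <= 2 ^ (#|gT| - #|gT| %/ 20))%N.
Proof.
move=> /centsP cTT sZC prC; have mC x y : x * y = y * x :> gT by apply: cTT; rewrite inE.
set m := #|Z|; set n := #|gT|.
pose X := [set B in rcosets Z [set: gT] | ~~ (B \subset C)].
have cosetC x : (Z :* x \subset C) = (x \in C).
  apply/idP/idP=> [/subsetP|Cx]; first by apply; apply: rcoset_refl.
  by rewrite mul_subG ?sub1set.
have memX x : (Z :* x \in X) = (x \notin C).
  by rewrite inE cosetC mem_rcosets; rewrite (subsetP (mulG_subr _ _)) ?inE.
have cardX : (#|X| * m = n - #|C|)%N.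
  have -> : X = rcosets Z [set: gT] :\: rcosets Z C.
    apply/setP=> B; rewrite !inE andbC; apply: andb_id2r => /rcosetsP[x _ ->].
    by rewrite cosetC mem_rcosets mulSGid.
  have sub : rcosets Z C \subset rcosets Z [set: gT] by apply: imsetS; apply: subsetT.
  rewrite cardsD (setIidPr sub) mulnBl mulnC [(#|rcosets Z C| * _)%N]mulnC.
  by rewrite !Lagrange ?subsetT // cardsT.
have leC : (2 * #|C| <= n)%N.
  rewrite /n -cardsT -(Lagrange (proper_sub prC)) mulnC leq_mul //.
  by rewrite indexg_gt1; case/andP: prC.
pose t (f : {ffun {set gT} -> gT}) x := x * f (Z :* x).
(* The value [1] off [X] makes [t f] the identity on [C]; on each coset in [X] it is a nontrivial
   translation. *)
pose F : {pred {ffun {set gT} -> gT}} := pffun_on 1 (mem X) (mem Z^#).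
have Ff f B : f \in F -> (f B \in Z) * ((f B == 1) = (B \notin X)).
  move/pffun_onP=> [sup im].
  have [XB|notXB] := boolP (B \in X).
    have /im : f B \in [seq f x | x in X] by apply/imageP; exists B.
    by case/setD1P=> /negPf-> ->.
  suff -> : f B = 1 by rewrite group1 eqxx.
  by apply/eqP; apply: contraR notXB => nt; apply: (subsetP sup); rewrite inE.
have tinj f : f \in F -> injective (t f).
  move=> Ff' x y; rewrite /t => eqt.
  have co z : Z :* z = Z :* t f z.
    by apply/rcoset_eqP; rewrite /t mC mem_rcoset invMg mulgA mulgV mul1g groupV Ff.
  suff eqc : Z :* x = Z :* y by move: eqt; rewrite eqc => /mulIg.
  by rewrite (co x) (co y) /t eqt.
pose stab f := [set S : {set gT} | [forall x, (t f x \in S) == (x \in S)]].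
have card_stab f : f \in F -> (#|stab f| ^ 2 <= 2 ^ (n + #|C|))%N.
  move=> Ff'; pose p := perm (tinj f Ff').
  have -> : stab f = [set S : {set gT} | [forall x, (p x \in S) == (x \in S)]].
    by apply/setP=> S; rewrite !inE; apply: eq_forallb => x; rewrite permE.
  apply: leq_trans (_ : (2 ^ #|porbits p|) ^ 2 <= _)%N.
    by rewrite leq_exp2r ?card_stable_sets.
  rewrite -expnM leq_exp2l // mulnC; apply: leq_trans (card_porbits_fix p) _.
  rewrite leq_add2l; apply/subset_leq_card/subsetP=> x; rewrite inE permE /t.
  by rewrite -[X in _ == X]mulg1 (inj_eq (mulgI x)) Ff // memX negbK.
set bad := [set S | _]; pose M := \max_(f in F) #|stab f|.
have leM : (M ^ 2 <= 2 ^ (n + #|C|))%N.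
  rewrite /M; elim/big_ind: _ => [|a b|f /card_stab] //.
  by rewrite /maxn; case: ifP.
have le_bad : (#|bad| <= #|F| * M)%N.
  have sub : bad \subset \bigcup_(f in F) stab f.
    apply/subsetP=> S; rewrite inE => /forallP stS.
    pose good (B : {set gT}) := [pred z in Z^# | [forall x in B, (x * z \in S) == (x \in S)]].
    (* On [X] a witness exists by [stS], so the default of [odflt] is never taken there. *)
    pose f := [ffun B : {set gT} => if B \in X then odflt 1 [pick z in good B] else 1].
    have goodf B : B \in X -> f B \in good B.
      move=> XB; rewrite ffunE XB; case: pickP => //= no.
      move: XB; rewrite inE => /andP[/rcosetsP[c _ defB]]; rewrite defB cosetC => notCc.
      have /implyP/(_ notCc)/exists_inP[z Zz stz] := stS c.
      by case/negP: (negbT (no z)); rewrite inE; apply/andP; rewrite defB.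
    apply/bigcupP; exists f.
      apply/pffun_onP; split=> [|_ /imageP[B XB ->]].
        by apply/subsetP=> B; rewrite inE ffunE; case: ifP => // _; rewrite eqxx.
      by have /andP[] := goodf B XB.
    rewrite inE; apply/forallP=> x; rewrite /t.
    have [XB|notXB] := boolP (Z :* x \in X); last first.
      by rewrite ffunE (negPf notXB) mulg1.
    by have /andP[_ /forall_inP] := goodf _ XB; apply; apply: rcoset_refl.
  apply: leq_trans (subset_leq_card sub) _; apply: leq_trans (card_bigcup_leq _ _) _.
  rewrite -sum_nat_const; apply: leq_sum => f Ff'.
  exact: (leq_bigmax_cond (F := fun f => #|stab f|)).
have leF : (#|F| ^ 5 <= 2 ^ (2 * (n - #|C|)))%N.
  rewrite card_pffun_on -cardX -expnM [(#|X| * 5)%N]mulnC expnM.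
  rewrite [(#|X| * m)%N]mulnC mulnA expnM expnM.
  have -> : #|mem Z^#| = m.-1 by rewrite /m (cardsD1 1 Z) group1.
  case: (posnP #|X|) => [->|X_gt0]; first by rewrite !expn0.
  by rewrite leq_exp2r // pred_exp5_leq_exp4.
(* The power 20 clears the denominators: the total exponent is [8 (n - #|C|) + 10 (n + #|C|) = 18 n
   + 2 #|C|], at most [19 n]. *)
rewrite -(leq_exp2r _ _ (e := 20)) //.
apply: leq_trans (_ : ((#|F| ^ 5) ^ 4 * (M ^ 2) ^ 10 <= _)%N).
  by rewrite -!expnM -expnMn leq_exp2r.
apply: leq_trans (_ : ((2 ^ (2 * (n - #|C|))) ^ 4 * (2 ^ (n + #|C|)) ^ 10 <= _)%N).
  by apply: leq_mul; rewrite leq_exp2r.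
rewrite -!expnM -expnD leq_exp2l // mulnBl -/n.
have : (#|C| <= n)%N by rewrite -[n]cardsT subset_leq_card ?subsetT.
have := leq_divM n 20; move: leC.
lia.
Qed.

(** Union bound over at most [2 ^ (k * k)] automorphisms and [2 ^ (2 * (k * k))] pairs [(Z, C)]; the
    successor in the exponent absorbs the sum of the two families. *)
Lemma card_not_DRR (gT : finGroupType) k :
    abelian [set: gT] -> (#|gT| < 2 ^ k)%N ->
  (#|[set S : {set gT} | ~~ is_DRR S]| <= 2 ^ ((2 * (k * k)).+1 + (#|gT| - #|gT| %/ 20)))%N.
Proof.
move=> cTT lt_n; set n := #|gT|; set e := (n - n %/ 20)%N.
pose auts := [set p : {perm gT} | [forall x, forall y, p (x * y) == p x * p y]].
pose stab (p : {perm gT}) := [set S : {set gT} | [forall x, (p x \in S) == (x \in S)]].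
pose good (ZC : {group gT} * {group gT}) := (ZC.1 \subset ZC.2) && (ZC.2 \proper [set: gT]).
pose trans (ZC : {group gT} * {group gT}) := [set S : {set gT} | translation_stable S ZC.1 ZC.2].
have sub : [set S | ~~ is_DRR S] \subset
    (\bigcup_(p in auts :\ 1) stab p) :|: (\bigcup_(ZC | good ZC) trans ZC).
  apply/subsetP=> S; rewrite inE => /(not_DRR_cases cTT)[[p [ntp Mp stp]]|[Z [C [sZC prC stS]]]].
    apply/setUP; left; apply/bigcupP; exists p.
      by rewrite !inE ntp; apply/forallP=> x; apply/forallP=> y; apply/eqP.
    by rewrite inE; apply/forallP=> x; apply/eqP.
  apply/setUP; right; apply/bigcupP; exists (Z, C); first by rewrite /good sZC.
  by rewrite inE.
have le_stab p : p \in auts :\ 1 -> (#|stab p| <= 2 ^ e)%N.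
  rewrite !inE => /andP[ntp /forallP Mp].
  apply: leq_trans (card_stable_sets p) _; rewrite leq_exp2l //.
  have {}Mp x y : p (x * y) = p x * p y by apply/eqP/(forallP (Mp x)).
  (* The fixed points of a nontrivial automorphism form a proper subgroup, hence at most half of the
     group, leaving at most [3n/4] cycles. *)
  have gF : group_set [set x | p x == x].
    apply/group_setP; split=> [|x y]; rewrite !inE.
      by apply/eqP/(mulgI (p 1)); rewrite -Mp !mulg1.
    by rewrite Mp => /eqP-> /eqP->.
  have le2 : (2 * #|[set x | p x == x]| <= n)%N.
    rewrite -[[set x | _]]/(gval (Group gF)) /n -cardsT -(Lagrange (subsetT (Group gF))) mulnC leq_mul // indexg_gt1.
    apply: contra ntp => /subsetP sTF; apply/eqP/permP=> x; rewrite perm1.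
    by have := sTF x (in_setT x); rewrite inE => /eqP.
  have := card_porbits_fix p; move: le2; rewrite /= -/n /e.
  have := leq_divM n 20; lia.
have le_trans ZC : good ZC -> (#|trans ZC| <= 2 ^ e)%N.
  by case/andP=> sZC prC; apply: card_translation_stable.
apply: leq_trans (subset_leq_card sub) _; apply: leq_trans (leq_card_setU _ _) _.
apply: leq_trans (leq_add (card_bigcup_leq _ _) (card_bigcup_leq _ _)) _.
apply: (@leq_trans (\sum_(p in (auts :\ 1)%g) 2 ^ e + \sum_(ZC | good ZC) 2 ^ e)%N).
  by apply: leq_add; apply: leq_sum.
rewrite !sum_nat_const -mulnDl expnD leq_mul2r; apply/orP; right.
rewrite expnS mul2n -addnn; apply: leq_add.
  apply: leq_trans (subset_leq_card (subsetDl _ _)) _.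
  by apply: leq_trans (card_automorphisms lt_n) _; rewrite leq_exp2l // mul2n -addnn leq_addl.
apply: leq_trans (max_card _) _; rewrite card_prod mul2n -addnn expnD.
by apply: leq_mul; apply: card_groups.
Qed.

(** * Asymptotics in the order of the group *)

(** The start is [1000 <= 1024]; from there each step multiplies the cube by at most
    [(11/10) ^ 3 < 2]. *)
Lemma cube_leq_exp2 t : (10 <= t)%N -> (t ^ 3 <= 2 ^ t)%N.
Proof.
move=> /subnK <-; elim: (t - 10)%N => [|i IH]; first by rewrite add0n; vm_compute.
rewrite addSn [in X in (_ <= X)%N]expnS.
apply: leq_trans (leq_mul (leqnn 2) IH); move: (i + 10)%N (leq_addl i 10) => j lej.
have le1 : (10 * j.+1 <= 11 * j)%N by lia.
rewrite -(leq_pmul2l (m := 10 ^ 3)) // -expnMn.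
apply: leq_trans (_ : (11 * j) ^ 3 <= _)%N; first by rewrite leq_exp2r.
by rewrite expnMn mulnA leq_mul2r; apply/orP; right; vm_compute.
Qed.

Lemma trunc_log_square_leq M :
  exists N, forall n, (N <= n)%N ->
    ((2 * ((trunc_log 2 n).+1 * (trunc_log 2 n).+1)).+1 + M <= n %/ 20)%N.
Proof.
(* For [t >= 1] the left side is at most [(9 + M) t ^ 2]. The threshold forces [t >= 20 (9 + M)], so
   20 times the left side is at most [t ^ 3 <= 2 ^ t <= n]. *)
exists (2 ^ (20 * (9 + M)))%N => n leN.
have n_gt0 : (0 < n)%N by apply: leq_trans leN; rewrite expn_gt0.
have := trunc_log_max (isT : 1 < 2)%N leN; have := trunc_logP (isT : 1 < 2)%N n_gt0.
move: (trunc_log 2 n) => t le2t let_.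
rewrite leq_divRL //; apply: leq_trans le2t; apply: leq_trans (cube_leq_exp2 _); last by lia.
apply: leq_trans (_ : (20 * (9 + M) * t ^ 2 <= _)%N); last first.
  by rewrite [(t ^ 3)%N]expnS leq_mul.
by rewrite expnS expn1; nia.
Qed.

End CayleyDigraphs.

Theorem theorem1p2 (R : archiRealFieldType) (eps : R) :
  0 < eps ->
  exists N : nat, forall gT : finGroupType,
    abelian [set: gT] -> (N <= #|gT|)%N ->
    (1 - eps) * 2%:R ^+ #|gT| <= (#|[set S : {set gT} | is_DRR S]|)%:R.
Proof.
(* Since [2 ^ M >= 1 / eps], the bound [bad * 2 ^ M <= 2 ^ n] below gives [bad <= eps * 2 ^ n]. *)
move=> eps_gt0; pose M := Num.bound eps^-1.
have epsM : 1 <= eps * 2%:R ^+ M.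
  rewrite mulrC -ler_pdivrMr // div1r; apply: ltW.
  apply: lt_le_trans (archi_boundP _) _; first by rewrite invr_ge0 ltW.
  by rewrite -natrX ler_nat ltnW // ltn_expl.
have [N ltN] := trunc_log_square_leq M.
exists N => gT cTT /ltN; set n := #|gT|; set k := (trunc_log 2 n).+1 => le_k.
have lt_n : (n < 2 ^ k)%N by apply: trunc_log_ltn.
have le_bad := card_not_DRR cTT lt_n.
set bad := #|_| in le_bad.
have le_badM : (bad * 2 ^ M <= 2 ^ n)%N.
  apply: leq_trans (leq_mul le_bad (leqnn _)) _; rewrite -expnD leq_exp2l //.
  by rewrite -/n; have := leq_div n 20; lia.
have -> : #|[set S : {set gT} | is_DRR S]| = (2 ^ n - bad)%N.
  have -> : (2 ^ n = #|{set gT}|)%N by rewrite -cardsT -powersetT card_powerset cardsT.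
  rewrite -(cardsC [set S : {set gT} | is_DRR S]).
  have -> : ~: [set S : {set gT} | is_DRR S] = [set S | ~~ is_DRR S].
    by apply/setP=> S; rewrite !inE.
  by rewrite addnK.
have le_bad2 : (bad <= 2 ^ n)%N.
  by apply: leq_trans le_badM; rewrite leq_pmulr ?expn_gt0.
rewrite natrB // natrX mulrBl mul1r lerD2l lerN2.
have le_badR : bad%:R * 2%:R ^+ M <= 2%:R ^+ n :> R by rewrite -!natrX -natrM ler_nat.
apply: le_trans (_ : eps * (bad%:R * 2%:R ^+ M) <= _); last by rewrite ler_pM2l.
by rewrite mulrCA ler_peMr ?ler0n.
Qed.
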